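(* Let $1<p<\infty$ and let $C_p:\ell^p\to\ell^p$ be the Cesàro operator $C_p(x)=\left(\frac1n\sum_{k=1}^n x_k\right)_{n=1}^\infty$, $x=(x_n)_{n=1}^\infty\in\ell^p$, which is a positive operator belonging to $\mathcal{L}(\ell^p)$. Then its order spectrum coincides with its spectrum, that is, $\sigma_{\rm o}(C_p)=\sigma(C_p)$.
   Context: $\mathbb{N}=\{1,2,\ldots\}$. $\ell^p$ is the complex Banach lattice of $p$-summable sequences in $\mathbb{C}^{\mathbb{N}}$ with its usual norm and the coordinatewise order. It is known (Hardy's inequality) that $C_p$ is well defined and continuous on $\ell^p$. For a complex Banach lattice $E$, $\mathcal{L}(E)$ is the unital Banach algebra of all continuous linear operators $E\to E$ (unit: the identity $I$). The spectrum of $T\in\mathcal{L}(E)$ is $\sigma(T)=\{\lambda\in\mathbb{C}:\lambda I-T \text{ is not invertible in }\mathcal{L}(E)\}$. An operator $T\in\mathcal{L}(E)$ is regular if it is a finite (complex) linear combination of positive operators; $\mathcal{L}^r(E)$ denotes the set of all regular operators, which is a unital algebra (a Banach algebra for the norm $\|T\|_r=\inf\{\|S\|_{\rm op}:S\in\mathcal{L}(E),\,S\ge0,\,|T(z)|\le S(|z|)\ \forall z\in E\}$). The order spectrum of $T\in\mathcal{L}^r(E)$ is $\sigma_{\rm o}(T)=\{\lambda\in\mathbb{C}:\lambda I-T\text{ is not invertible in }\mathcal{L}^r(E)\}$. *)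

(* Defs.v *)
From HB Require Import structures.
From mathcomp Require Import all_boot all_order all_algebra.
From mathcomp Require Import complex.
From mathcomp Require Import all_classical all_reals all_analysis.
From mathcomp Require Import ring lra.

Set Implicit Arguments.
Unset Strict Implicit.
Unset Printing Implicit Defensive.

Import Order.TTheory GRing.Theory Num.Theory.
Import numFieldNormedType.Exports.

Local Open Scope classical_set_scope.
Local Open Scope ring_scope.
Local Open Scope complex_scope.

Section lp_norm.
Context {R : realType}.
Implicit Types (p : R) (x y : nat -> R[i]).

(* [lp_enorm p x] is (\sum_n |x_n|^p)^(1/p), possibly +oo; [Normc.normc] is
   the real-valued modulus on [R[i]]. *)
Definition lp_enorm p x : \bar R :=
  'N[counting]_p%:E [EFin \o (@Normc.normc R \o x)]%E.

Definition lp_pred p : {pred nat -> R[i]} :=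
  mem [set x | (lp_enorm p x < +oo)%E].

Lemma normcC x n : (Normc.normc (x n))%:C = `|x n|.
Proof. by []. Qed.

Lemma normc_ge0 (z : R[i]) : 0 <= Normc.normc z.
Proof. by case: z => a b; rewrite sqrtr_ge0. Qed.

Lemma normcD (z w : R[i]) :
  Normc.normc (z + w) <= Normc.normc z + Normc.normc w.
Proof. exact: le_normcD. Qed.

Lemma lp_enormE p x : 0 < p -> lp_enorm p x =
  ((\sum_(n <oo) (Normc.normc (x n) `^ p)%:E) `^ p^-1)%E.
Proof.
move=> p0; rewrite /lp_enorm Lnorm_counting//; congr (_ `^ _)%E.
by apply: eq_eseriesr => n _; rewrite gee0_abs ?lee_fin ?normc_ge0.
Qed.

Lemma lp_predE p x : 0 < p ->
  (x \in lp_pred p) = (\sum_(n <oo) (Normc.normc (x n) `^ p)%:E < +oo)%E.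
Proof.
move=> p0; apply/idP/idP.
  by rewrite inE /= lp_enormE//; apply: lty_poweRy; rewrite invr_neq0 ?gt_eqF.
by rewrite inE /= lp_enormE// => /poweR_lty; exact.
Qed.

Lemma le_lp_enorm p x y : 0 < p ->
  (forall n, Normc.normc (x n) <= Normc.normc (y n)) ->
  (lp_enorm p x <= lp_enorm p y)%E.
Proof.
move=> p0 xy; rewrite !lp_enormE//; apply: gt0_ler_poweR.
- by rewrite invr_ge0 ltW.
- by rewrite in_itv/= leey andbT nneseries_ge0// => n _ _; rewrite lee_fin powR_ge0.
- by rewrite in_itv/= leey andbT nneseries_ge0// => n _ _; rewrite lee_fin powR_ge0.
- apply: lee_nneseries => [n _ _|n _]; first by rewrite lee_fin powR_ge0.
  by rewrite lee_fin ge0_ler_powR ?nnegrE ?normc_ge0// ltW.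
Qed.

Lemma lp_enormD p x y : 1 <= p ->
  (lp_enorm p (x + y)%R <= lp_enorm p x + lp_enorm p y)%E.
Proof.
move=> p1; have p0 : 0 < p by exact: lt_le_trans p1.
pose z n : R[i] := (Normc.normc (x n) + Normc.normc (y n))%:C.
have zE n : Normc.normc (z n) = Normc.normc (x n) + Normc.normc (y n).
  by rewrite /z /= expr0n addr0 sqrtr_sqr ger0_norm// addr_ge0 ?normc_ge0.
apply: (@le_trans _ _ (lp_enorm p z)).
  by apply: le_lp_enorm => // n; rewrite zE normcD.
rewrite {1}/lp_enorm; have -> : @Normc.normc R \o z = (fun n => Normc.normc (x n)) \+ (fun n => Normc.normc (y n)) by apply/funext => n; exact: zE.
exact: (@minkowski_EFin _ _ _ counting (fun n => Normc.normc (x n))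
  (fun n => Normc.normc (y n)) p).
Qed.

Lemma lp_enormZ p x (c : R[i]) : 0 < p ->
  (lp_enorm p (c *: x)%R = (Normc.normc c)%:E * lp_enorm p x)%E.
Proof.
move=> p0; rewrite !lp_enormE//.
under eq_eseriesr.
  move=> n _; rewrite -[(c *: x) n]/(c * x n) Normc.normcM powRM ?normc_ge0//.
  rewrite EFinM; over.
rewrite nneseriesZl; last by move=> n _; rewrite lee_fin powR_ge0.
rewrite poweRM ?lee_fin ?powR_ge0//.
  by rewrite poweR_EFin -powRrM mulfV ?gt_eqF// powRr1 ?normc_ge0.
by apply: nneseries_ge0 => n _ _; rewrite lee_fin powR_ge0.
Qed.

Lemma lp_enorm0 p : 0 < p -> lp_enorm p 0 = 0%E.
Proof.
move=> p0; rewrite lp_enormE// eseries0 ?poweR0r ?invr_neq0 ?gt_eqF//.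
by move=> n _ _; rewrite Normc.normc0 powR0// gt_eqF.
Qed.

Lemma lp_enorm_ge0 p x : (0 <= lp_enorm p x)%E.
Proof. exact: Lnorm_ge0. Qed.

Lemma normc_le_lp_enorm p x n : 0 < p ->
  ((Normc.normc (x n))%:E <= lp_enorm p x)%E.
Proof.
move=> p0; rewrite lp_enormE//.
have -> : (Normc.normc (x n))%:E = ((Normc.normc (x n) `^ p)%:E `^ p^-1)%E.
  by rewrite poweR_EFin -powRrM mulfV ?gt_eqF// powRr1 ?normc_ge0.
apply: gt0_ler_poweR.
- by rewrite invr_ge0 ltW.
- by rewrite in_itv/= leey andbT lee_fin powR_ge0.
- by rewrite in_itv/= leey andbT nneseries_ge0// => m _ _; rewrite lee_fin powR_ge0.
- apply: (@le_trans _ _ (\sum_(0 <= k < n.+1) (Normc.normc (x k) `^ p)%:E)%E).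
    rewrite big_nat_recr//= leeDr// sume_ge0// => k _.
    by rewrite lee_fin powR_ge0.
  by apply: nneseries_lim_ge => k _ _; rewrite lee_fin powR_ge0.
Qed.

Lemma lp_submod_closed p : 1 <= p -> submod_closed (lp_pred p).
Proof.
move=> p1; have p0 : 0 < p by exact: lt_le_trans p1.
split; first by rewrite inE /= lp_enorm0.
move=> c x y; rewrite !inE /= => x_lp y_lp.
apply: le_lt_trans (lp_enormD _ _ p1) _.
by rewrite lp_enormZ// lte_add_pinfty// lte_mul_pinfty ?lee_fin ?normc_ge0.
Qed.

End lp_norm.

(* The sequence (x_1, x_2, ...) is stored with indices shifted to 0, 1, ... *)
Record lp (R : realType) (p : R) (p1 : 1 <= p) :=
  Lp { lp_seq :> nat -> R[i] ; lp_seqP : lp_seq \in lp_pred p }.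

Section lp_structures.
Context {R : realType} {p : R} (p1 : 1 <= p).
Let p0 : 0 < p. Proof. exact: lt_le_trans p1. Qed.

HB.instance Definition _ := [isSub for @lp_seq R p p1].
HB.instance Definition _ := [Choice of lp p1 by <:].
HB.instance Definition _ := GRing.isSubmodClosed.Build _ _ (lp_pred p)
  (lp_submod_closed p1).
HB.instance Definition _ := [SubChoice_isSubLmodule of lp p1 by <:].

Definition lp_norm (x : lp p1) : R[i] := (fine (lp_enorm p x))%:C.

Lemma lp_enorm_fin (x : lp p1) : lp_enorm p x \is a fin_num.
Proof. by rewrite ge0_fin_numE ?lp_enorm_ge0//; have := lp_seqP x; rewrite inE. Qed.

Lemma lp_normD x y : lp_norm (x + y) <= lp_norm x + lp_norm y.
Proof.
rewrite /lp_norm -rmorphD lecR -fineD ?lp_enorm_fin//.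
rewrite fine_le ?fin_numD ?lp_enorm_fin//.
exact: (lp_enormD x y p1).
Qed.

Lemma lp_normZ (c : R[i]) x : lp_norm (c *: x) = `|c| * lp_norm x.
Proof.
by rewrite /lp_norm (lp_enormZ x c p0) fineM ?lp_enorm_fin// rmorphM.
Qed.

Lemma lp_norm0_eq0 x : lp_norm x = 0 -> x = 0.
Proof.
move=> [x0]; apply/val_inj/funext => n /=.
apply: Normc.eq0_normc; apply/eqP; rewrite eq_le normc_ge0 andbT.
by rewrite -lee_fin (le_trans (normc_le_lp_enorm x n p0))// -(fineK (lp_enorm_fin x)) x0.
Qed.

HB.instance Definition _ := Lmodule_isNormed.Build R[i] (lp p1)
  lp_normD lp_normZ lp_norm0_eq0.

(* Coordinatewise order; in [R[i]], [z <= w] means that [w - z] is a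
   nonnegative real. *)
Definition lp_le (x y : lp p1) : bool := `[< forall n, x n <= y n >].
Definition lp_lt (x y : lp p1) : bool := (y != x) && lp_le x y.

Lemma lp_le_refl : reflexive lp_le.
Proof. by move=> x; apply/asboolP. Qed.

Lemma lp_le_anti : antisymmetric lp_le.
Proof.
move=> x y /andP[/asboolP xy /asboolP yx]; apply/val_inj/funext => n /=.
by apply/eqP; rewrite eq_le xy yx.
Qed.

Lemma lp_le_trans : transitive lp_le.
Proof.
move=> y x z /asboolP xy /asboolP yz; apply/asboolP => n.
exact: le_trans (xy n) (yz n).
Qed.

HB.instance Definition _ := Order.isPOrder.Build ring_display (lp p1)
  (fun _ _ => erefl) lp_le_refl lp_le_anti lp_le_trans.

End lp_structures.

Section hardy.
Context {R : realType} {p : R} (p1 : 1 < p).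
Context {a : nat -> R} (a_ge0 : forall n, 0 <= a n).
Let q := p / (p - 1).
Let A n := n%:R^-1 * \sum_(k < n) a k.

Let p0 : 0 < p. Proof. exact: lt_trans p1. Qed.
Let q0 : 0 < q. Proof. by rewrite divr_gt0// subr_gt0. Qed.
Let pN0 : p != 0. Proof. exact: lt0r_neq0. Qed.
Let pB1N0 : p - 1 != 0. Proof. by rewrite subr_eq0 gt_eqF. Qed.
Let pq1 : p^-1 + q^-1 = 1.
Proof. by rewrite /q; field; rewrite pN0 pB1N0. Qed.
Let A_ge0 n : 0 <= A n.
Proof. by rewrite mulr_ge0// sumr_ge0. Qed.

Let powR_split (x : R) : 0 <= x -> x `^ p = x `^ (p - 1) * x.
Proof.
move=> x0; have [->|xN0] := eqVneq x 0; first by rewrite mulr0 powR0.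
by rewrite -{3}(powRr1 x0) -powRD ?subrK// xN0 implybT.
Qed.

Let young (x y : R) : 0 <= x -> 0 <= y ->
  x `^ (p - 1) * y <= x `^ p / q + y `^ p / p.
Proof.
move=> x0 y0; have := conjugate_powR (powR_ge0 x (p - 1)) y0 q0 p0.
have qE : (p - 1) * q = p by rewrite /q mulrCA mulfV// mulr1.
by rewrite (addrC q^-1) -powRrM qE; exact.
Qed.

Let hardy_telescope N :
  \sum_(n < N) (A n.+1 `^ p - q * (A n.+1 `^ (p - 1) * a n))
  <= - (N%:R * A N `^ p / (p - 1)).
Proof.
have pB1 : 0 < p - 1 by rewrite subr_gt0.
elim: N => [|N IH]; first by rewrite big_ord0 mul0r mul0r oppr0.
rewrite big_ord_recr/=; apply: le_trans (lerD IH (lexx _)) _.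
have aE : a N = N.+1%:R * A N.+1 - N%:R * A N.
  rewrite /A mulrA mulfV ?pnatr_eq0// mul1r big_ord_recr/=.
  case: (N) => [|M]; first by rewrite big_ord0 mul0r subr0 add0r.
  by rewrite mulrA mulfV ?pnatr_eq0// mul1r addrAC subrr add0r.
have Y := young (A_ge0 N.+1) (A_ge0 N).
have -> : A N.+1 `^ (p - 1) * a N =
    N.+1%:R * A N.+1 `^ p - N%:R * (A N.+1 `^ (p - 1) * A N).
  by rewrite (powR_split (A_ge0 N.+1)) aE; ring.
have NY := ler_wpM2l (mulr_ge0 (ltW q0) (ler0n R N)) Y.
move: NY; set X := A N.+1 `^ p; set Z := _ * A N; set W := A N `^ p.
have -> : q * N%:R * (X / q + W / p) = N%:R * X + N%:R * W / (p - 1).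
  by rewrite /q; field; rewrite pN0 pB1N0.
have -> : - (N.+1%:R * X / (p - 1)) = X + N%:R * X - q * (N.+1%:R * X).
  by rewrite /q -natr1; field.
rewrite !mulrBr (mulrA q); lra.
Qed.

Lemma hardy_ineq N :
  \sum_(n < N) (n.+1%:R^-1 * \sum_(k < n.+1) a k) `^ p
  <= q `^ p * \sum_(n < N) a n `^ p.
Proof.
have H1 : \sum_(n < N) A n.+1 `^ p <=
    \sum_(n < N) A n.+1 `^ (p - 1) * (q * a n).
  rewrite -subr_le0 -sumrB; under eq_bigr do rewrite mulrCA.
  apply: le_trans (hardy_telescope N) _.
  by rewrite oppr_le0 divr_ge0 ?mulr_ge0 ?powR_ge0// subr_ge0 ltW.
have H2 : \sum_(n < N) A n.+1 `^ (p - 1) * (q * a n) <=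
    \sum_(n < N) (A n.+1 `^ p / q + (q * a n) `^ p / p).
  apply: ler_sum => n _.
  by apply: young; rewrite ?A_ge0// mulr_ge0// ltW.
have := le_trans H1 H2; rewrite big_split/= -2!mulr_suml.
under [X in _ + X / p]eq_bigr do rewrite powRM ?(ltW q0)//.
rewrite -mulr_sumr; set X := \sum_(n < N) _; set Y := _ * _.
rewrite -lerBlDl (_ : X - X / q = X * p^-1); last first.
  by rewrite -{1}(mulr1 X) -pq1; ring.
by rewrite ler_pM2r ?invr_gt0.
Qed.

End hardy.

Section cesaro.
Context {R : realType} {p : R} (p1 : 1 < p).

(* With the index shift, the term of index n averages the first n+1 terms. *)
Definition cesaro_seq (x : nat -> R[i]) (n : nat) : R[i] :=
  n.+1%:R^-1 * \sum_(k < n.+1) x k.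

Lemma normc_cesaro_seq (x : nat -> R[i]) n : Normc.normc (cesaro_seq x n) <=
  n.+1%:R^-1 * \sum_(k < n.+1) Normc.normc (x k).
Proof.
rewrite -lecR -[leLHS]/(`|cesaro_seq x n|) /cesaro_seq normrM.
rewrite rmorphM fmorphV rmorph_nat ger0_norm ?invr_ge0//.
rewrite ler_wpM2l ?invr_ge0// rmorph_sum.
exact: ler_norm_sum.
Qed.

Lemma cesaro_lp (x : lp (ltW p1)) : cesaro_seq x \in lp_pred p.
Proof.
have p0 : 0 < p by exact: lt_trans p1.
have := lp_seqP x; rewrite !lp_predE//; set S := limn _ => S_fin.
apply: (@le_lt_trans _ _ (((p / (p - 1)) `^ p)%:E * S)%E); last first.
  by rewrite lte_mul_pinfty ?lee_fin ?powR_ge0.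
apply: lime_le.
  by apply: is_cvg_nneseries => n _ _; rewrite lee_fin powR_ge0.
apply: nearW => N.
apply: (@le_trans _ _ (((p / (p - 1)) `^ p)%:E *
    (\sum_(0 <= n < N) (Normc.normc (x n) `^ p)%:E))%E); last first.
  rewrite lee_wpmul2l ?lee_fin ?powR_ge0//.
  by apply: nneseries_lim_ge => n _ _; rewrite lee_fin powR_ge0.
rewrite !big_mkord !sumEFin -EFinM lee_fin.
apply: le_trans (hardy_ineq p1 (fun n => normc_ge0 (x n)) N).
apply: ler_sum => n _.
apply: ge0_ler_powR; rewrite ?nnegrE ?normc_ge0 ?normc_cesaro_seq//.
- exact: ltW.
- by rewrite mulr_ge0// sumr_ge0// => k _; exact: normc_ge0.
Qed.

Definition cesaro_op (x : lp (ltW p1)) : lp (ltW p1) := Lp (ltW p1) (cesaro_lp x).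

End cesaro.

Arguments cesaro_op {R p} p1 x.

Section spectra.
Context {K : numFieldType} {E : normedModType K}.
Implicit Types (T S : E -> E) (A : set (E -> E)).

Definition bounded_op : set (E -> E) := [set T | linear T /\ continuous T].

(* For a unital subalgebra [A] of the algebra of operators on [E]. *)
Definition invertible_in A T :=
  A T /\ exists S, [/\ A S, S \o T = id & T \o S = id].

Definition spectrum_in A T : set K :=
  [set lambda | ~ invertible_in A (lambda *: (@id E) - T)].

Definition spectrum T := spectrum_in bounded_op T.

End spectra.

Section regular.
Context {R : realType} {p : R} {p1 : 1 <= p}.
Let E := lp p1.

Definition positive_op : set (E -> E) :=
  [set T | bounded_op T /\ forall x : E, 0 <= x -> 0 <= T x].

Definition regular_op : set (E -> E) :=
  [set T | exists n (c : 'I_n -> R[i]) (S : 'I_n -> E -> E),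
     (forall i, positive_op (S i)) /\ T = \sum_(i < n) c i *: S i].

Definition order_spectrum (T : E -> E) : set R[i] := spectrum_in regular_op T.

End regular.

(* Main.v *)
(* Put mu = 1/lambda and alpha = Re mu, with indices n >= 1. If
   (lambda - C) x = y and S_n = x_1 + ... + x_n, then
     (1 - mu/n) S_n = S_(n-1) + mu y_n   and   x_n = mu (y_n + S_n/n),
   so that (lambda - C)^-1, when it exists, is mu I + mu^2 K for a lower
   triangular K with entries 1/(n \prod_(m <= k <= n) (1 - mu/k)).
   For y = e_1 and alpha >= 1 - 1/p the recurrence gives
   |S_n| >= c n^(1 - 1/p), so that (S_n/n) is not in l^p; invertibility of
   lambda - C in L(l^p) thus forces alpha < 1 - 1/p. Now
   |1 - mu/k| >= 1 - alpha/k, so the entries of K are dominated by those of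
   the positive kernel obtained by replacing mu by alpha, and for alpha < 1 - 1/p the latter satisfies a Hardy inequality with
   constant 1/(1 - 1/p - alpha). Hence K is a combination of four positive
   operators. *)

From HB Require Import structures.
Require Import Defs.
From mathcomp Require Import all_boot all_order all_algebra.
From mathcomp Require Import complex.
From mathcomp Require Import all_classical all_reals all_analysis.
From mathcomp Require Import ring lra.

Set Implicit Arguments.
Unset Strict Implicit.
Unset Printing Implicit Defensive.

Import Order.TTheory GRing.Theory Num.Theory.
Import numFieldNormedType.Exports.

Local Open Scope classical_set_scope.
Local Open Scope ring_scope.
Local Open Scope complex_scope.

(** * Weighted Hardy inequality and a divergence criterion *)

(** Young's inequality with conjugate exponents [p / (p - 1)] and [p], the first factor being
    already a power. *)
Lemma young_powR (R : realType) (p x y : R) : 1 < p -> 0 <= x -> 0 <= y ->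
  x `^ (p - 1) * y <= (1 - p^-1) * x `^ p + p^-1 * y `^ p.
Proof.
move=> p1 x0 y0; have p0 : 0 < p by exact: lt_trans p1.
have pB1 : 0 < p - 1 by rewrite subr_gt0.
have pN0 := lt0r_neq0 p0; have pB1N0 := lt0r_neq0 pB1.
have q0 : 0 < p / (p - 1) by rewrite divr_gt0.
have pq1 : (p / (p - 1))^-1 + p^-1 = 1.
  by rewrite invf_div mulrBl mulfV// mul1r subrK.
have := conjugate_powR (powR_ge0 x (p - 1)) y0 q0 p0 pq1.
rewrite -powRrM (_ : (p - 1) * (p / (p - 1)) = p); last by rewrite mulrCA mulfV ?mulr1.
rewrite (_ : (p / (p - 1))^-1 = 1 - p^-1); last by apply/eqP; rewrite eq_sym subr_eq pq1.
by rewrite ![_ * (1 - _)]mulrC [_ `^ p / p]mulrC; exact.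
Qed.

Lemma powR_subr1M (R : realType) (p x : R) : 1 < p -> 0 <= x ->
  x `^ (p - 1) * x = x `^ p.
Proof.
move=> p1 x0; have p0 : p != 0 by rewrite gt_eqF// (lt_trans _ p1).
have [->|xN0] := eqVneq x 0; first by rewrite mulr0 powR0.
by rewrite -{2}(powRr1 x0) -powRD ?subrK// xN0 implybT.
Qed.

Section weighted_hardy.
Context {R : realType} {p : R} (p1 : 1 < p) {alpha : R}.
Hypothesis alpha_lt : alpha < 1 - p^-1.
Context {a A : nat -> R}.
Hypothesis a_ge0 : forall n, 0 <= a n.
Hypothesis A_ge0 : forall n, 0 <= A n.
(* For [n = 0] the factor [n%:R] cancels the junk value [A n.-1 = A 0]. *)
Hypothesis AE : forall n, (n.+1%:R - alpha) * A n = n%:R * A n.-1 + a n.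
Let delta := 1 - p^-1 - alpha.

(** Eliminating [a n] through [AE] leaves one mixed term in [A n] and [A n.-1]. Young's inequality
    splits it with exactly the weights that make the sum telescope. *)
Let weighted_telescope N :
  \sum_(n < N) (delta * A n `^ p - A n `^ (p - 1) * a n)
  <= - (N%:R * p^-1 * A N.-1 `^ p).
Proof.
elim: N => [|N IH]; first by rewrite big_ord0 !mul0r oppr0.
rewrite big_ord_recr/=; apply: le_trans (lerD IH (lexx _)) _.
have -> : a N = (N.+1%:R - alpha) * A N - N%:R * A N.-1.
  by rewrite AE addrAC subrr add0r.
rewrite mulrBr mulrCA (powR_subr1M p1)// [_ * (N%:R * _)]mulrCA.
have := ler_wpM2l (ler0n R N) (young_powR p1 (A_ge0 N) (A_ge0 N.-1)).
set X := A N `^ p; set Z := _ * A N.-1; set W := A N.-1 `^ p.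
rewrite /delta -natr1 => NY; rewrite -subr_ge0; move: NY; rewrite -subr_ge0.
by congr (0 <= _); ring.
Qed.

Lemma weighted_hardy N :
  \sum_(n < N) A n `^ p <= (delta^-1) `^ p * \sum_(n < N) a n `^ p.
Proof.
have p0 : 0 < p by exact: lt_trans p1.
have d0 : 0 < delta by rewrite subr_gt0.
have H1 : \sum_(n < N) delta * A n `^ p <= \sum_(n < N) A n `^ (p - 1) * a n.
  rewrite -subr_le0 -sumrB; apply: le_trans (weighted_telescope N) _.
  by rewrite oppr_le0 mulr_ge0 ?powR_ge0// mulr_ge0// invr_ge0 ltW.
(* Young's inequality is applied to [A n] and [delta^-1 * a n]: the part [delta * (1 - p^-1)] is
   absorbed by the left side of [H1], which leaves [delta * p^-1]. *)
have H2 : \sum_(n < N) A n `^ (p - 1) * a n <= \sum_(n < N)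
    (delta * (1 - p^-1) * A n `^ p + delta * p^-1 * (delta^-1 * a n) `^ p).
  apply: ler_sum => n _; rewrite -!mulrA -mulrDr.
  have -> : A n `^ (p - 1) * a n = delta * (A n `^ (p - 1) * (delta^-1 * a n)).
    by rewrite [RHS]mulrCA mulVKf ?lt0r_neq0.
  rewrite ler_pM2l// young_powR// mulr_ge0// invr_ge0 ltW//.
have := le_trans H1 H2; rewrite big_split/= -!mulr_sumr.
under [X in _ + _ * X]eq_bigr do rewrite powRM ?invr_ge0 ?(ltW d0)//.
rewrite -mulr_sumr; set X := \sum_(n < N) A n `^ p; set Y := \sum_(n < N) _.
move=> H; have dp : 0 < delta * p^-1 by rewrite mulr_gt0// invr_gt0.
rewrite -(ler_pM2l dp) -subr_ge0; move: H; rewrite -subr_ge0.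
by congr (0 <= _); ring.
Qed.

End weighted_hardy.
Lemma ln_le_subr1 (R : realType) (x : R) : 0 < x -> ln x <= x - 1.
Proof.
move=> x0; rewrite -{1}(subrK 1 x) addrC; apply: le_ln1Dx.
by rewrite -subr_gt0 opprK subrK.
Qed.

(* The loss is a telescoping term, so [ln (n.+1%:R * A n `^ p)] stays bounded
   below along the recurrence. *)
Lemma ln_powR_increment (R : realType) (p M w A0 A1 : R) (n : nat) : 1 < p ->
  0 <= M -> 0 < w -> 0 < A0 -> 0 < A1 ->
  n.+2%:R * w * A1 = n.+1%:R * A0 ->
  w ^+ 2 <= 1 - 2 * (1 - p^-1) / n.+2%:R + M / n.+2%:R ^+ 2 ->
  ln (n.+1%:R * A0 `^ p) - (p + p * M) * (n.+1%:R^-1 - n.+2%:R^-1)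
  <= ln (n.+2%:R * A1 `^ p).
Proof.
move=> p1 M0 w0 A00 A10 AE w2; have p0 : 0 < p by exact: lt_trans p1.
have n0 : 0 < n.+1%:R :> R by rewrite ltr0n.
have m0 : 0 < n.+2%:R :> R by rewrite ltr0n.
have lnw : 2 * ln w <= - (2 * (1 - p^-1) / n.+2%:R) + M / n.+2%:R ^+ 2.
  rewrite mulr_natl -lnXn//; apply: le_trans (ln_le_subr1 _) _.
    by rewrite exprn_gt0.
  by rewrite lerBlDl addrA.
have lnn : ln n.+2%:R - ln n.+1%:R <= n.+1%:R^-1 :> R.
  rewrite -ln_div ?posrE//; apply: le_trans (ln_le_subr1 _) _.
    by rewrite divr_gt0.
  by rewrite -(natr1 n.+1) mulrDl mulfV ?gt_eqF// mul1r addrAC subrr add0r.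
(* Turns the quadratic error term into a telescoping difference. *)
have invB : (n.+2%:R ^+ 2)^-1 <= n.+1%:R^-1 - n.+2%:R^-1 :> R.
  rewrite (_ : _ - _ = (n.+1%:R * n.+2%:R)^-1); last first.
    have natE : n.+2%:R = n.+1%:R + 1 :> R by rewrite natr1.
    move: n0 m0; rewrite natE; move: n.+1%:R => t t0 t10.
    by field; rewrite !gt_eqF.
  by rewrite lef_pV2 ?posrE ?mulr_gt0// expr2 ler_pM2r// ler_nat.
have /(congr1 (@ln R)) := AE; rewrite !lnM ?posrE ?mulr_gt0 ?powR_gt0// !ln_powR.
move: lnw lnn invB; rewrite -/(M / n.+2%:R ^+ 2).
set i := n.+1%:R^-1; set j := n.+2%:R^-1; set jj := (n.+2%:R ^+ 2)^-1.
move: (ln n.+1%:R) (ln n.+2%:R) (ln w) (ln A0) (ln A1) => ln1 ln2 lw a0 a1.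
move=> lnw lnn invB lnE; rewrite (_ : a0 = ln2 + lw + a1 - ln1); last first.
  by rewrite lnE; ring.
have pN0 : p != 0 by rewrite gt_eqF.
have H1 : p * (2 * lw) <= p * (- (2 * (1 - p^-1) * j) + M * jj) by rewrite ler_pM2l.
have E1 : p * (- (2 * (1 - p^-1) * j) + M * jj) = - (2 * (p - 1) * j) + p * (M * jj).
  by field.
(* The growth [(p - 1) * i] almost cancels the decay [(p - 1) * j] found in half of [E1]; the
   remainder [(p - 1) * (i - j)] telescopes. *)
have H2 : (p - 1) * (ln2 - ln1) <= (p - 1) * i.
  by rewrite ler_wpM2l// subr_ge0 ltW.
have H3 : p * M * jj <= p * M * (i - j) by rewrite ler_wpM2l// mulr_ge0// ltW.
have H4 : 0 <= i - j.
  by apply: le_trans invB; rewrite invr_ge0 exprn_ge0// ltW.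
have H5 : 0 <= p * M * (i - j) by rewrite !mulr_ge0// ltW.
rewrite E1 in H1; lra.
Qed.

Lemma harmonic_minorant_dvg (R : realType) (c : R) (u : nat -> R) : 0 < c ->
  (forall n, c / n.+1%:R <= u n) -> (\sum_(n <oo) (u n)%:E)%E = +oo%E.
Proof.
move=> c0 cu; have u0 n : 0 <= u n by apply: le_trans (cu n); rewrite divr_ge0// ltW.
apply/eqP; rewrite eq_le leey/= leNgt; apply/negP => /(nnseries_is_cvg u0) u_cvg.
have : cvgn (series (fun n : nat => c / n.+1%:R)).
  by apply: series_le_cvg u_cvg => // n; rewrite divr_ge0// ltW.
move=> /(@is_cvg_seriesZ R _ c^-1); rewrite (_ : _ *: _ = @harmonic R).
  exact: dvg_harmonic.
by apply/funext => n; rewrite /= -[LHS]/(c^-1 * (c / n.+1%:R)) mulKf ?gt_eqF.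
Qed.

Section divergence.
Context {R : realType} {p M : R} (p1 : 1 < p) (M0 : 0 <= M) {w A : nat -> R}.
Hypothesis w_gt0 : forall n, 0 < w n.
Hypothesis A_gt0 : forall n, 0 < A n.
Hypothesis AE : forall n, n.+2%:R * w n.+1 * A n.+1 = n.+1%:R * A n.
Hypothesis w_le : forall n,
  w n ^+ 2 <= 1 - 2 * (1 - p^-1) / n.+1%:R + M / n.+1%:R ^+ 2.

(** The losses in [ln_powR_increment] add up to at most [p + p * M], so [n.+1] times the [p]-th
    power of [A n] stays above a positive constant, and a multiple of the harmonic series is a
    minorant. *)
Lemma powR_series_dvg : (\sum_(n <oo) (A n `^ p)%:E)%E = +oo%E.
Proof.
have L n : ln (A 0%N `^ p) - (p + p * M) * (1 - n.+1%:R^-1)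
    <= ln (n.+1%:R * A n `^ p).
  elim: n => [|n IH]; first by rewrite invr1 subrr mulr0 subr0 mul1r.
  apply: le_trans (ln_powR_increment p1 M0 _ _ _ (AE n) (w_le n.+1)) => //.
  rewrite -subr_ge0; move: IH; rewrite -subr_ge0.
  by congr (0 <= _); ring.
have p0 : 0 < p by exact: lt_trans p1.
apply: (@harmonic_minorant_dvg _ (expR (ln (A 0%N `^ p) - (p + p * M)))).
  exact: expR_gt0.
move=> n; rewrite ler_pdivrMr ?ltr0n// [leRHS]mulrC.
rewrite -[leRHS]lnK ?posrE ?mulr_gt0 ?powR_gt0 ?ltr0n// ler_expR.
apply: le_trans (L n); rewrite lerD2l lerN2 ler_piMr//.
  by rewrite addr_ge0 ?mulr_ge0 ?(ltW p0).
Qed.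

End divergence.

(** * Operators with a dominated lower triangular kernel *)

Section operators.
Context {R : realType} {p : R} {p1 : 1 <= p}.
Local Notation E := (lp p1).
Implicit Types (T U : E -> E) (h k : nat -> nat -> R) (M : R).
Let p0 : 0 < p. Proof. exact: lt_le_trans p1. Qed.

Lemma lp_ext (x y : E) : (forall n, x n = y n) -> x = y.
Proof. by move=> xy; apply/val_inj/funext. Qed.

Lemma bounded_op_id : bounded_op (@id E).
Proof. by split => // x; exact: cvg_id. Qed.

Lemma bounded_opD T U : bounded_op T -> bounded_op U -> bounded_op (T + U).
Proof.
move=> [Tlin Tc] [Ulin Uc]; split=> [c x y|x].
  by rewrite -![(T + U) _]/(T _ + U _) Tlin Ulin scalerDr addrACA.
exact: continuousD (Tc x) (Uc x).
Qed.

Lemma bounded_opZ (c : R[i]) T : bounded_op T -> bounded_op (c *: T).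
Proof.
move=> [Tlin Tc]; split=> [d x y|x].
  by rewrite -![(c *: T) _]/(c *: T _) Tlin scalerDr !scalerA mulrC.
exact: continuous_comp (Tc x) (@scaler_continuous _ _ c (T x)).
Qed.

Lemma positive_op_id : positive_op (@id E).
Proof. by split => //; exact: bounded_op_id. Qed.

Lemma positive_regular T : positive_op T -> regular_op T.
Proof.
move=> T_pos; exists 1%N, (fun=> 1), (fun=> T); split => //.
by rewrite big_ord1 scale1r.
Qed.

Lemma regular_opZ (c : R[i]) T : regular_op T -> regular_op (c *: T).
Proof.
move=> [n [d [S [S_pos ->]]]]; exists n, (fun i => c * d i), S; split => //.
by rewrite scaler_sumr; apply: eq_bigr => i _; rewrite scalerA.
Qed.

Lemma regular_opD T U : regular_op T -> regular_op U -> regular_op (T + U).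
Proof.
move=> [n [d [S [S_pos ->]]]] [m [e [V [V_pos ->]]]].
exists (n + m)%N, (fun i => match fintype.split i with inl j => d j
    | inr j => e j end),
  (fun i => match fintype.split i with inl j => S j | inr j => V j end); split.
  by move=> i; case: fintype.split.
rewrite big_split_ord/=; congr (_ + _); apply: eq_bigr => i _.
  by rewrite (unsplitK (inl i)).
by rewrite (unsplitK (inr i)).
Qed.

Lemma regular_bounded T : regular_op T -> bounded_op T.
Proof.
move=> [n [c [S [S_pos ->]]]]; elim/big_ind : _ => //.
- split=> [d x y|x]; last exact: (@cst_continuous _ _ (0 : E)).
  by rewrite -![(0 : E -> E) _]/(0 : E) scaler0 addr0.
- by move=> *; exact: bounded_opD.
- by move=> i _; apply: bounded_opZ; case: (S_pos i).
Qed.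

Lemma regular_op_sub_cesaro (c : R[i]) T : positive_op T ->
  regular_op (c *: (@id E) - T).
Proof.
move=> T_pos; rewrite -scaleN1r; apply: regular_opD; apply: regular_opZ.
  exact: positive_regular positive_op_id.
exact: positive_regular.
Qed.

(** Partial sums are finite for every sequence, so an infinite norm does no harm; [M] enters the
    norm of [x] as a scalar multiple. *)
Lemma le_lp_enorm_partial M (x y : nat -> R[i]) : 0 <= M ->
  (forall N, \sum_(n < N) Normc.normc (y n) `^ p
    <= M `^ p * \sum_(n < N) Normc.normc (x n) `^ p) ->
  (lp_enorm p y <= M%:E * lp_enorm p x)%E.
Proof.
move=> M0 yx; have normM : Normc.normc M%:C = M.
  by rewrite /= expr0n addr0 sqrtr_sqr ger0_norm.
rewrite -[in leRHS]normM -lp_enormZ// !lp_enormE//.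
have ge0 (u : nat -> R[i]) : (0 <= \sum_(n <oo) (Normc.normc (u n) `^ p)%:E)%E.
  by apply: nneseries_ge0 => n _ _; rewrite lee_fin powR_ge0.
apply: gt0_ler_poweR; rewrite ?in_itv/= ?leey ?ge0//.
  by rewrite invr_ge0 ltW.
apply: lime_le.
  by apply: is_cvg_nneseries => n _ _; rewrite lee_fin powR_ge0.
apply: nearW => N; apply: (@le_trans _ _
    (\sum_(0 <= n < N) (Normc.normc ((M%:C *: x) n) `^ p)%:E)%E); last first.
  by apply: nneseries_lim_ge => n _ _; rewrite lee_fin powR_ge0.
rewrite !big_mkord !sumEFin lee_fin; apply: le_trans (yx N) _.
rewrite mulr_sumr; apply: ler_sum => n _.
by rewrite -[(_ *: x) n]/(M%:C * x n) Normc.normcM normM powRM ?normc_ge0.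
Qed.

(** For nonnegative [k] and [M], this bounds the norm of the lower triangular kernel on l^p by [M].
    Finite sections suffice because row [n] involves only entries up to [n]. *)
Definition kernel_bound k M := forall a : nat -> R, (forall n, 0 <= a n) ->
  forall N, \sum_(n < N) (\sum_(m < n.+1) k n m * a m) `^ p
    <= M `^ p * \sum_(n < N) a n `^ p.

(** Here [y] is a bare sequence, so that the estimate can also show that the image of an element of
    l^p lies in l^p. *)
Lemma positive_kernel_enorm k M (x y : nat -> R[i]) : 0 <= M ->
  (forall n m, 0 <= k n m) -> kernel_bound k M ->
  (forall n, y n = \sum_(m < n.+1) (k n m)%:C * x m) ->
  (lp_enorm p y <= M%:E * lp_enorm p x)%E.
Proof.
move=> M0 k0 kM yE; apply: le_lp_enorm_partial => // N.
apply: le_trans (kM (fun n => Normc.normc (x n)) (fun n => normc_ge0 (x n)) N).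
apply: ler_sum => n _; apply: ge0_ler_powR; rewrite ?nnegrE ?normc_ge0 ?(ltW p0)//.
  by rewrite sumr_ge0// => m _; rewrite mulr_ge0 ?normc_ge0.
rewrite -lecR -[leLHS]/(`|y n|) yE rmorph_sum; apply: le_trans (ler_norm_sum _ _ _) _.
apply: ler_sum => m _; rewrite rmorphM normrM ler_wpM2r//.
by rewrite ger0_norm// ler0c.
Qed.

Lemma positive_kernel k M T : 0 <= M -> (forall n m, 0 <= k n m) ->
  kernel_bound k M -> (forall x n, T x n = \sum_(m < n.+1) (k n m)%:C * x m) ->
  positive_op T.
Proof.
move=> M0 k0 kM TE.
have Tlin : linear T.
  move=> c x y; apply: lp_ext => n.
  rewrite -[RHS]/(c * T x n + T y n) !TE mulr_sumr -big_split/=.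
  by apply: eq_bigr => m _; rewrite mulrDr mulrCA.
have T_norm x : `|T x| <= M%:C * `|x|.
  rewrite -[`|x|]/(lp_norm x) -[`|T x|]/(lp_norm (T x)) -rmorphM lecR.
  rewrite -lee_fin EFinM !fineK ?lp_enorm_fin//.
  exact: positive_kernel_enorm (TE x).
split.
  split=> //; pose f : {linear E -> E} := HB.pack T (GRing.isLinear.Build _ _ _ _ T Tlin).
  apply: (@bounded_linear_continuous _ _ _ f); apply/linear_boundedP.
  exists M%:C; split; first by rewrite ger0_real// ler0c.
  move=> r Mr x; apply: le_trans (T_norm x) _.
  by rewrite ler_wpM2r// ltW.
move=> x /asboolP x0; apply/asboolP => n; rewrite TE sumr_ge0// => m _.
by rewrite mulr_ge0 ?ler0c//; exact: x0.
Qed.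

Lemma positive_kernel_ex k M : 0 <= M -> (forall n m, 0 <= k n m) ->
  kernel_bound k M ->
  exists2 T : E -> E, positive_op T &
    forall x n, T x n = \sum_(m < n.+1) (k n m)%:C * x m.
Proof.
move=> M0 k0 kM; pose y (x : E) n := \sum_(m < n.+1) (k n m)%:C * x m.
have y_lp x : y x \in lp_pred p.
  rewrite inE /=; apply: le_lt_trans (positive_kernel_enorm M0 k0 kM (fun=> erefl)) _.
  by rewrite lte_mul_pinfty ?lee_fin ?lp_enorm_fin//; have := lp_seqP x; rewrite inE.
by exists (fun x => Lp p1 (y_lp x)) => //; exact: positive_kernel kM _.
Qed.

Lemma kernel_bound_le k k' M : (forall n m, 0 <= k n m <= k' n m) ->
  kernel_bound k' M -> kernel_bound k M.
Proof.
move=> kk' k'M a a0 N; apply: le_trans (k'M a a0 N).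
have k0 n m : 0 <= k n m by have /andP[] := kk' n m.
have le n m : k n m <= k' n m by have /andP[] := kk' n m.
apply: ler_sum => n _; apply: ge0_ler_powR; rewrite ?nnegrE ?(ltW p0)//.
- by rewrite sumr_ge0// => m _; rewrite mulr_ge0.
- by rewrite sumr_ge0// => m _; rewrite mulr_ge0// (le_trans (k0 n m)).
- by apply: ler_sum => m _; rewrite ler_wpM2r.
Qed.

(** The positive and negative parts of [k] are both dominated by [h]; the operator is the difference
    of the two positive operators they define. *)
Lemma real_kernel_regular h k M : 0 <= M -> (forall n m, `|k n m| <= h n m) ->
  kernel_bound h M ->
  exists2 T : E -> E, regular_op T &
    forall x n, T x n = \sum_(m < n.+1) (k n m)%:C * x m.
Proof.
move=> M0 kh hM; pose kp n m := Num.max (k n m) 0; pose kn n m := Num.max (- k n m) 0.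
have kp0 n m : 0 <= kp n m by rewrite le_max lexx orbT.
have kn0 n m : 0 <= kn n m by rewrite le_max lexx orbT.
have h0 n m : 0 <= h n m by exact: le_trans (kh n m).
have kpM : kernel_bound kp M.
  apply: kernel_bound_le hM => n m; rewrite kp0 ge_max h0 andbT.
  exact: le_trans (ler_norm _) (kh n m).
have knM : kernel_bound kn M.
  apply: kernel_bound_le hM => n m; rewrite kn0 ge_max h0 andbT.
  by apply: le_trans (ler_norm _) _; rewrite normrN.
have [T T_pos TE] := positive_kernel_ex M0 kp0 kpM.
have [U U_pos UE] := positive_kernel_ex M0 kn0 knM.
exists (T + (-1) *: U).
  apply: regular_opD; first exact: positive_regular.
  by apply: regular_opZ; exact: positive_regular.
move=> x n; rewrite -[LHS]/(T x n + (-1) * U x n) TE UE mulN1r -sumrB.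
apply: eq_bigr => m _; rewrite -mulrBl -rmorphB; congr (_%:C * _).
rewrite /kp /kn; have [k_ge0|/ltW k_le0] := leP 0 (k n m).
  by rewrite max_r ?oppr_le0// subr0.
by rewrite max_l ?oppr_ge0// sub0r opprK.
Qed.

(** The real and imaginary parts of an entry do not exceed its modulus, so the real case applies to
    each. *)
Lemma kernel_regular (k : nat -> nat -> R[i]) h M : 0 <= M ->
  (forall n m, Normc.normc (k n m) <= h n m) -> kernel_bound h M ->
  exists2 T : E -> E, regular_op T &
    forall x n, T x n = \sum_(m < n.+1) k n m * x m.
Proof.
move=> M0 kh hM.
have [T T_reg TE] : exists2 T : E -> E, regular_op T &
    forall x n, T x n = \sum_(m < n.+1) (complex.Re (k n m))%:C * x m.
  apply: (@real_kernel_regular h (fun n m => complex.Re (k n m)) M) => // n m.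
  apply: le_trans (kh n m).
  by case: (k n m) => a b /=; rewrite -sqrtr_sqr ler_wsqrtr// lerDl sqr_ge0.
have [U U_reg UE] : exists2 T : E -> E, regular_op T &
    forall x n, T x n = \sum_(m < n.+1) (complex.Im (k n m))%:C * x m.
  apply: (@real_kernel_regular h (fun n m => complex.Im (k n m)) M) => // n m.
  apply: le_trans (kh n m).
  by case: (k n m) => a b /=; rewrite -sqrtr_sqr ler_wsqrtr// lerDr sqr_ge0.
exists (T + 'i%C *: U); first by apply: regular_opD => //; exact: regular_opZ.
move=> x n; rewrite -[LHS]/(T x n + 'i%C * U x n) TE UE mulr_sumr -big_split/=.
by apply: eq_bigr => m _; rewrite [in RHS](complexE (k n m)) mulrDl mulrA.
Qed.

End operators.

(** * Complex moduli, first-order recurrences and the resolvent kernel *)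

Section complex_modulus.
Context {R : realType}.

Lemma Re_le_normc (z : R[i]) : complex.Re z <= Normc.normc z.
Proof.
case: z => a b /=; apply: le_trans (ler_norm a) _.
by rewrite -sqrtr_sqr ler_wsqrtr// lerDl sqr_ge0.
Qed.

Lemma normc_prod (I : Type) (r : seq I) (P : pred I) (F : I -> R[i]) :
  Normc.normc (\prod_(i <- r | P i) F i) = \prod_(i <- r | P i) Normc.normc (F i).
Proof. exact: (big_morph _ (@Normc.normcM R) (@Normc.normc1 R)). Qed.

Lemma natc (n : nat) : n%:R = (n%:R : R)%:C.
Proof. by rewrite rmorph_nat. Qed.

Lemma normc_real (x : R) : Normc.normc x%:C = `|x|.
Proof. by rewrite /= expr0n addr0 sqrtr_sqr. Qed.

Lemma normc_sign (n : nat) : Normc.normc ((-1) ^+ n : R[i]) = 1.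
Proof.
by rewrite -(rmorphN1 (real_complex R)) -rmorphXn normc_real normrX normrN1 expr1n.
Qed.

End complex_modulus.

(** Multiplying by [v n] cancels the last factor of each product. Serves both the Hardy bound for
    the kernel and the solution formula for the resolvent. *)
Lemma kernel_recurrence (F : fieldType) (v a : nat -> F) :
  (forall n, v n != 0) -> forall n,
  v n * (\sum_(m < n.+1) (\prod_(m <= k < n.+1) (v k)^-1) * a m) =
  \sum_(m < n) (\prod_(m <= k < n) (v k)^-1) * a m + a n.
Proof.
move=> v0 n; rewrite big_ord_recr/= big_nat1 mulrDr mulVKf//; congr (_ + _).
rewrite mulr_sumr; apply: eq_bigr => m _.
by rewrite big_nat_recr ?(ltnW (ltn_ord m))//= mulrA mulrCA mulfV ?mulr1.
Qed.

Lemma first_order_recurrence (F : fieldType) (v a s : nat -> F) :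
  (forall n, v n != 0) -> s 0%N = 0 ->
  (forall n, v n * s n.+1 = s n + a n) ->
  forall n, s n = \sum_(m < n) (\prod_(m <= k < n) (v k)^-1) * a m.
Proof.
move=> v0 s0 sE; elim=> [|n IH]; first by rewrite big_ord0.
by apply: (mulfI (v0 n)); rewrite sE IH kernel_recurrence.
Qed.

(* With [mu = lambda^-1], the kernel K for which
   [(lambda - C)^-1 = mu I + mu^2 K]; row [n] here is row n+1 on paper. *)
Definition resolvent_kernel (F : fieldType) (mu : F) (n m : nat) : F :=
  n.+1%:R^-1 * \prod_(m <= k < n.+1) (1 - mu / k.+1%:R)^-1.

Section resolvent_bound.
Context {R : realType} {p : R} (p1 : 1 < p).

Lemma resolvent_weight_gt0 (alpha : R) k : alpha < 1 -> 0 < 1 - alpha / k.+1%:R.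
Proof.
move=> a1; rewrite subr_gt0 ltr_pdivrMr ?ltr0n// mul1r.
by rewrite (lt_le_trans a1)// ler1n.
Qed.

(** By [kernel_recurrence], the kernel sums satisfy the hypothesis [AE] of [weighted_hardy]. *)
Lemma resolvent_kernel_bound (alpha : R) : alpha < 1 - p^-1 ->
  kernel_bound (p := p) (resolvent_kernel alpha) (1 - p^-1 - alpha)^-1.
Proof.
move=> ha a a0 N.
have a1 : alpha < 1.
  by apply: lt_trans ha _; rewrite ltrBlDr ltrDl invr_gt0 (lt_trans _ p1).
have v0 n : 1 - alpha / n.+1%:R != 0 by rewrite gt_eqF ?resolvent_weight_gt0.
apply: (@weighted_hardy _ _ p1 _ ha a
  (fun n => \sum_(m < n.+1) resolvent_kernel alpha n m * a m)) => // n.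
  rewrite sumr_ge0// => m _; rewrite mulr_ge0// mulr_ge0// prodr_ge0// => k _.
  by rewrite invr_ge0 ltW// resolvent_weight_gt0.
under eq_bigr do rewrite -mulrA; rewrite -mulr_sumr.
have -> : n.+1%:R - alpha = (1 - alpha / n.+1%:R) * n.+1%:R.
  by rewrite mulrBl mul1r mulfVK.
rewrite -mulrA mulVKf ?pnatr_eq0// kernel_recurrence//; congr (_ + _).
(* At [n = 0] the empty sum matches the factor [0] in front of [A n.-1]. *)
case: n => [|n]/=; first by rewrite big_ord0 mul0r.
under [in RHS]eq_bigr do rewrite -mulrA; rewrite -mulr_sumr mulVKf// pnatr_eq0//.
Qed.

Lemma Re_resolvent_weight (mu : R[i]) n :
  complex.Re (1 - mu / n.+1%:R) = 1 - complex.Re mu / n.+1%:R.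
Proof.
by rewrite natc -fmorphV; case: mu => a b; simpc.
Qed.

Lemma normc_resolvent_kernel (mu : R[i]) n m : complex.Re mu < 1 ->
  Normc.normc (resolvent_kernel mu n m) <= resolvent_kernel (complex.Re mu) n m.
Proof.
move=> mu1; rewrite /resolvent_kernel Normc.normcM normc_prod.
rewrite {1}natc -fmorphV normc_real ger0_norm ?invr_ge0// ler_wpM2l ?invr_ge0//.
apply: ler_prod => k _; rewrite normc_ge0/= Normc.normcV.
have w0 := resolvent_weight_gt0 k mu1; rewrite lef_pV2 ?posrE//.
  by rewrite -Re_resolvent_weight Re_le_normc.
by apply: lt_le_trans w0 _; rewrite -Re_resolvent_weight Re_le_normc.
Qed.

(** When the real part of [mu] is at least [1 - p^-1], this yields [w_le] of the divergence
    criterion, with [M] the squared modulus of [mu]. *)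
Lemma sqr_normc_resolvent_weight (mu : R[i]) n :
  Normc.normc (1 - mu / n.+1%:R) ^+ 2 =
  1 - 2 * complex.Re mu / n.+1%:R + Normc.normc mu ^+ 2 / n.+1%:R ^+ 2.
Proof.
rewrite natc -fmorphV; case: mu => a b; simpc.
rewrite !sqr_sqrtr ?addr_ge0 ?sqr_ge0//.
by rewrite -exprVn/=; ring.
Qed.

End resolvent_bound.

(** * The resolvent of the Cesaro operator *)

Section cesaro_resolvent.
Context {R : realType} {p : R} (p1 : 1 < p).
Local Notation E := (lp (ltW p1)).
Let p0 : 0 < p. Proof. exact: lt_trans p1. Qed.

Lemma cesaro_positive : positive_op (cesaro_op p1).
Proof.
pose k n (m : nat) : R := n.+1%:R^-1.
apply: (@positive_kernel _ _ _ k (p / (p - 1))) => //.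
- by rewrite divr_ge0 ?subr_ge0 ?(ltW p0)// ltW.
- by move=> n m; rewrite invr_ge0.
- move=> a a0 N; under eq_bigr do rewrite -mulr_sumr; exact: hardy_ineq.
- by move=> x n; rewrite /k -mulr_sumr fmorphV rmorph_nat.
Qed.

Lemma cesaro_shiftE (lambda : R[i]) (x : E) n :
  (lambda *: (@id E) - cesaro_op p1) x n =
  lambda * x n - n.+1%:R^-1 * \sum_(k < n.+1) x k.
Proof. by []. Qed.

Lemma delta_lp (m : nat) : (fun n => (n == m)%:R : R[i]) \in lp_pred p.
Proof.
rewrite lp_predE// (nneseriesD1 (n := m))//; last first.
  by move=> n _; rewrite lee_fin powR_ge0.
rewrite eseries0 ?adde0 ?ltry// => n _ /negbTE ->.
by rewrite Normc.normc0 powR0// gt_eqF.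
Qed.

(** The moduli are the Cesaro means of the first unit vector, so Hardy's inequality gives
    membership. *)
Lemma harmonic_sign_lp : (fun n => (-1) ^+ n / n.+1%:R : R[i]) \in lp_pred p.
Proof.
have := cesaro_lp (Lp (ltW p1) (delta_lp 0)).
rewrite !inE /=; apply: le_lt_trans; apply: le_lp_enorm => // n.
rewrite /cesaro_seq big_ord_recl big1 ?addr0 ?mulr1// Normc.normcM.
by rewrite normc_sign mul1r.
Qed.

(** A preimage of the alternating harmonic sequence would have partial sums [(-1) ^+ n], hence terms
    of modulus at least 1. This rules out invertibility at [lambda = 0]. *)
Lemma cesaro_not_surjective : exists y : E, forall x, cesaro_op p1 x <> y.
Proof.
exists (Lp (ltW p1) harmonic_sign_lp) => x.
move=> /(congr1 (@lp_seq _ _ _)) xE.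
have xS n : \sum_(k < n.+1) x k = (-1) ^+ n.
  have /(congr1 (fun u => u n)) := xE; rewrite /= /cesaro_seq => /(congr1 ( *%R n.+1%:R)).
  by rewrite mulVKf ?pnatr_eq0// [in RHS]mulrC divfK ?pnatr_eq0.
have xn n : x n.+1 = (-1) ^+ n.+1 * 2.
  have := xS n.+1; rewrite big_ord_recr/= xS => /(canRL (addKr _)) ->.
  by rewrite exprS; ring.
have x_ge1 n : 1 <= Normc.normc (x n).
  case: n => [|n]; last first.
    by rewrite xn Normc.normcM normc_sign mul1r natc normc_real ger0_norm// ler1n.
  by have := xS 0%N; rewrite big_ord1 => ->; rewrite normc_sign.
have := lp_seqP x; rewrite lp_predE// (harmonic_minorant_dvg ltr01)// => n.
apply: (@le_trans _ _ 1); first by rewrite ler_pdivrMr ?ltr0n// mul1r ler1n.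
apply: (@le_trans _ _ (1 `^ p)); first by rewrite powR1.
by rewrite ge0_ler_powR ?nnegrE ?normc_ge0// ltW.
Qed.

Section resolvent_equation.
Context {lambda : R[i]} (lambda0 : lambda != 0) {x y : nat -> R[i]}.
Hypothesis xE : forall n, lambda * x n - n.+1%:R^-1 * \sum_(k < n.+1) x k = y n.

Lemma resolvent_sum n : (1 - lambda^-1 / n.+1%:R) * \sum_(k < n.+1) x k =
  \sum_(k < n) x k + lambda^-1 * y n.
Proof.
rewrite -xE mulrBr mulKf// mulrBl mul1r -mulrA big_ord_recr/=; ring.
Qed.

Lemma resolvent_term n :
  x n = lambda^-1 * y n + lambda^-1 * (n.+1%:R^-1 * \sum_(k < n.+1) x k).
Proof. by rewrite -mulrDr -xE subrK mulKf. Qed.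

End resolvent_equation.

Section resolvent.
Context {lambda : R[i]} {T : E -> E}.
Hypothesis TE : (lambda *: (@id E) - cesaro_op p1) \o T = id.

Lemma resolventE y n : lambda * T y n - n.+1%:R^-1 * \sum_(k < n.+1) T y k = y n.
Proof. by rewrite -cesaro_shiftE -[(_ - _) _]/((_ \o T) y) TE. Qed.

Lemma resolvent_lambda_neq0 : lambda != 0.
Proof.
apply/negP => /eqP l0; have [y yC] := cesaro_not_surjective.
apply: (yC (- T y)); apply: lp_ext => n.
rewrite -(resolventE y n) l0 mul0r sub0r /= /cesaro_seq -mulrN -sumrN.
by [].
Qed.

(** If the weight at [n] vanished, then [lambda^-1 = n.+1%:R] and all earlier weights would be
    nonzero. Testing on the unit vector at [n], the partial sums before [n] vanish, and row [n]
    reads [0 = lambda^-1]. *)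
Lemma resolvent_weight_neq0 n : 1 - lambda^-1 / n.+1%:R != 0.
Proof.
apply/negP => /eqP w0.
have lE : lambda^-1 = n.+1%:R.
  move/eqP: w0; rewrite subr_eq0 => /eqP/esym/(canRL (divfK _)) ->.
    by rewrite mul1r.
  by rewrite pnatr_eq0.
pose y : E := Lp (ltW p1) (delta_lp n).
have S0 k : (k <= n)%N -> \sum_(j < k) T y j = 0.
  elim: k => [|k IH] kn; first by rewrite big_ord0.
  have := resolvent_sum resolvent_lambda_neq0 (resolventE y) k.
  rewrite IH ?(ltnW kn)// add0r /= (ltn_eqF kn) mulr0 => /eqP.
  rewrite mulf_eq0 lE subr_eq0 => /orP[|/eqP//].
  rewrite eq_sym -(inj_eq (mulIf (_ : k.+1%:R != 0))) ?pnatr_eq0//.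
  by rewrite divfK ?pnatr_eq0// mul1r eqr_nat eqSS gtn_eqF.
have := resolvent_sum resolvent_lambda_neq0 (resolventE y) n.
rewrite w0 mul0r S0// add0r /= eqxx mulr1 lE => /esym/eqP.
by rewrite pnatr_eq0.
Qed.

Lemma Re_resolvent_lt : complex.Re lambda^-1 < 1 - p^-1.
Proof.
rewrite ltNge; apply/negP => ha.
pose y : E := Lp (ltW p1) (delta_lp 0).
(* These are the moduli of the Cesaro means of [T y], which lie in l^p by Hardy's inequality; the
   contradiction is that their [p]-th powers have a divergent sum. *)
pose A n := Normc.normc (cesaro_seq (T y) n).
have S_rec := resolvent_sum resolvent_lambda_neq0 (resolventE y).
have nn (n : nat) : Normc.normc (n%:R : R[i]) = n%:R.
  by rewrite natc normc_real ger0_norm.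
have w_gt0 n : 0 < Normc.normc (1 - lambda^-1 / n.+1%:R).
  rewrite lt_neqAle normc_ge0 andbT eq_sym; apply: contra_neq (resolvent_weight_neq0 n).
  exact: Normc.eq0_normc.
(* Beyond index 0 the source [y] vanishes, so the recurrence is homogeneous and passes to moduli. *)
have AE n : n.+2%:R * Normc.normc (1 - lambda^-1 / n.+2%:R) * A n.+1 = n.+1%:R * A n.
  rewrite /A -!nn -!Normc.normcM /cesaro_seq; congr (Normc.normc _).
  rewrite mulVKf ?pnatr_eq0// mulrAC mulVKf ?pnatr_eq0//.
  by rewrite mulrC S_rec /= mulr0 addr0.
have A_gt0 n : 0 < A n.
  elim: n => [|n IH].
    rewrite /A lt_neqAle normc_ge0 andbT eq_sym; apply/eqP => /Normc.eq0_normc.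
    move=> A0; have := S_rec 0%N; rewrite big_ord0 /= mulr1 add0r.
    move: A0; rewrite /cesaro_seq invr1 mul1r => ->; rewrite mulr0 => /esym/eqP.
    by rewrite invr_eq0 (negbTE resolvent_lambda_neq0).
  have : 0 < n.+2%:R * Normc.normc (1 - lambda^-1 / n.+2%:R) * A n.+1.
    by rewrite AE mulr_gt0.
  by rewrite pmulr_rgt0// mulr_gt0.
have := cesaro_lp (T y); rewrite lp_predE//.
rewrite (powR_series_dvg p1 (sqr_ge0 (Normc.normc lambda^-1)) w_gt0 A_gt0 AE)//.
move=> n; rewrite sqr_normc_resolvent_weight lerD2r lerD2l lerN2.
by rewrite ler_pM2r ?invr_gt0// ler_pM2l.
Qed.

(** With nonzero weights the recurrence for the partial sums of [T y] has a single solution, which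
    forces [T] to be the kernel operator. *)
Lemma resolvent_regular : regular_op T.
Proof.
have ha := Re_resolvent_lt.
have a1 : complex.Re lambda^-1 < 1.
  by apply: lt_trans ha _; rewrite ltrBlDr ltrDl invr_gt0.
have M0 : 0 <= (1 - p^-1 - complex.Re lambda^-1)^-1 by rewrite invr_ge0 subr_ge0 ltW.
have [K K_reg KE] := kernel_regular (p1 := ltW p1) M0
  (fun n m => normc_resolvent_kernel n m a1) (resolvent_kernel_bound p1 ha).
suff -> : T = lambda^-1 *: (@id E) + (lambda^-1 ^+ 2) *: K.
  apply: regular_opD; apply: regular_opZ => //.
  exact: positive_regular positive_op_id.
apply/funext => y; apply: lp_ext => n.
rewrite -[RHS]/(lambda^-1 * y n + lambda^-1 ^+ 2 * K y n) KE.
rewrite (resolvent_term resolvent_lambda_neq0 (resolventE y)); congr (_ + _).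
rewrite (first_order_recurrence resolvent_weight_neq0 _
  (resolvent_sum resolvent_lambda_neq0 (resolventE y))) ?big_ord0//.
rewrite expr2 -mulrA; congr (_ * _); rewrite !mulr_sumr; apply: eq_bigr => m _.
by rewrite /resolvent_kernel; ring.
Qed.

End resolvent.
End cesaro_resolvent.

Theorem proposition4p2 (R : realType) (p : R) (p1 : 1 < p) :
  positive_op (cesaro_op p1) /\
  order_spectrum (cesaro_op p1) = spectrum (cesaro_op p1).
Proof.
have C_pos := cesaro_positive p1; split=> //.
(* Spectra are complements, so each inclusion becomes a transfer of invertibility, first from
   bounded to regular operators, then back. *)
apply/seteqP; split=> lambda; apply: contra_not => -[_ [T [T_in TL TR]]].
  split; first exact: regular_op_sub_cesaro.
  by exists T; split=> //; exact: resolvent_regular TR.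
split; first exact/regular_bounded/regular_op_sub_cesaro.
by exists T; split=> //; exact: regular_bounded.
Qed.
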